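(* Let $\Omega\subset\mathbb{R}^{2d}$ be measurable with $|\Omega|>0$, and let $S$ be a bounded operator on $L^2(\mathbb{R}^d)$. Then $$\Lambda_{\infty,\Omega}(S):=\sup_{f\in L^2(\mathbb{R}^d)\setminus\{0\}}\frac{\|Q_Sf\|_{L^\infty(\Omega)}}{\|f\|_{L^2}^2}=w(S),$$ where $w(S)=\sup_{\|g\|_{L^2}=1}|\langle Sg,g\rangle|$ is the numerical radius of $S$. In particular, if the numerical radius of $S$ is attained (that is, $|\langle Sg,g\rangle|=w(S)$ for some $g$ with $\|g\|_{L^2}=1$), then the supremum $\Lambda_{\infty,\Omega}(S)$ is attained as well.
   Context: $L^2(\mathbb{R}^d)$ is a complex Hilbert space with inner product linear in the first entry. For $z=(x,\xi)\in\mathbb{R}^{2d}$, $\pi(z)f(y)=e^{2\pi i\xi\cdot y}f(y-x)$; for a bounded operator $S$ on $L^2(\mathbb{R}^d)$, $\alpha_z(S)=\pi(z)S\pi(z)^*$ and $Q_Sf(z)=\langle\alpha_z(S)f,f\rangle$. $L^\infty(\Omega)$ carries the essential supremum norm with respect to Lebesgue measure. *)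

(* Defs.v *)
From HB Require Import structures.
From mathcomp Require Import all_boot all_order all_algebra.
From mathcomp Require Import generic_quotient ring_quotient ring lra complex.
From mathcomp Require Import all_classical all_reals all_analysis.
From mathcomp Require Import measurable_realfun.
Set Implicit Arguments.
Unset Strict Implicit.
Unset Printing Implicit Defensive.
Import Order.TTheory GRing.Theory Num.Theory.
Import numFieldNormedType.Exports.
Import ComplexField.Normc.
Local Open Scope classical_set_scope.
Local Open Scope complex_scope.
Local Open Scope ring_scope.

(* R^d with its Borel sigma-algebra, generated by the coordinate maps. *)
Notation euclid R d := (d.-tuple (measurableTypeR R)).

(* The library registers a sigma-finite structure on m1 \x m2, but canonical
   inference does not find it outside the (sub)probability case. *)
Lemma sigma_finite_product d1 d2 (T1 : measurableType d1)
    (T2 : measurableType d2) (R : realType)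
    (m1 : {sigma_finite_measure set T1 -> \bar R})
    (m2 : {sigma_finite_measure set T2 -> \bar R}) :
  sigma_finite setT (m1 \x m2)%E.
Proof.
have /sigma_finiteP[F [TF ndF Foo]] := sigma_finiteT m1.
have /sigma_finiteP[G [TG ndG Goo]] := sigma_finiteT m2.
exists (fun n => F n `*` G n).
  rewrite -setXTT TF TG predeqE => -[x y]; split.
    move=> [/= [n _ Fnx] [k _ Gky]]; exists (maxn n k) => //; split.
    - by move: x Fnx; exact/subsetPset/ndF/leq_maxl.
    - by move: y Gky; exact/subsetPset/ndG/leq_maxr.
  by move=> [n _ []/= ? ?]; split; exists n.
move=> k; have [? ?] := Foo k; have [? ?] := Goo k.
split; first exact: measurableX.
by rewrite product_measure1E// lte_mul_pinfty// ge0_fin_numE.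
Qed.

Section lebesgue.
Variable R : realType.

Definition vcons n (p : measurableTypeR R * euclid R n) : euclid R n.+1 :=
  [tuple of p.1 :: p.2].

Lemma measurable_vcons n : measurable_fun setT (@vcons n).
Proof. exact: measurable_cons. Qed.

Section step.
Variables (n : nat) (mu : {sigma_finite_measure set (euclid R n) -> \bar R}).

Definition lebesgue_step : set (euclid R n.+1) -> \bar R :=
  pushforward ((@lebesgue_measure R) \x mu)%E (@vcons n).

Let step0 : lebesgue_step set0 = 0%E.
Proof. by rewrite /lebesgue_step /pushforward preimage_set0 measure0. Qed.

Let step_ge0 A : (0 <= lebesgue_step A)%E.
Proof. by rewrite /lebesgue_step /pushforward; apply: measure_ge0. Qed.

Let step_sigma_additive : semi_sigma_additive lebesgue_step.
Proof.
have mc := @measurable_vcons n.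
exact: (@measure_semi_sigma_additive _ _ _ (pushforward _ (@vcons n))).
Qed.

HB.instance Definition _ :=
  isMeasure.Build _ _ _ lebesgue_step step0 step_ge0 step_sigma_additive.

Let step_sigma_finite : sigma_finite setT lebesgue_step.
Proof.
have [F TF mF] := sigma_finite_product (@lebesgue_measure R) mu.
pose g (t : euclid R n.+1) : measurableTypeR R * euclid R n :=
  (thead t, [tuple of behead t]).
have mg : measurable_fun setT g.
  apply/measurable_fun_pairP; split.
    exact: measurable_tnth.
  exact: measurable_behead.
have gK : cancel (@vcons n) g.
  by move=> [x t]; rewrite /g /vcons theadE; congr (_, _); exact/val_inj.
exists (fun k => g @^-1` (F k)).
  by rewrite -preimage_bigcup -TF preimage_setT.
move=> k; have [mFk Fkoo] := mF k; split.
  by rewrite -[X in measurable X]setTI; exact: mg.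
rewrite /lebesgue_step /pushforward -comp_preimage.
by rewrite (_ : g \o _ = id) //; apply/funext => p; exact: gK.
Qed.

HB.instance Definition _ :=
  @Measure_isSigmaFinite.Build _ _ _ lebesgue_step step_sigma_finite.

End step.

(* Lebesgue measure on R^(n+1) is the image of lebesgue_measure \x (Lebesgue
   measure on R^n) under (x, t) |-> x :: t; on R^0 it is the unit point mass. *)
Fixpoint lebesgue_euclid (n : nat) :
    {sigma_finite_measure set (euclid R n) -> \bar R} :=
  match n with
  | 0 => @dirac _ (euclid R 0) [tuple] R
  | n'.+1 => lebesgue_step (lebesgue_euclid n')
  end.

End lebesgue.

Section translation.
Variable R : realType.

Definition vsub n (y x : euclid R n) : euclid R n :=
  [tuple tnth y i - tnth x i | i < n].
Definition vopp n (x : euclid R n) : euclid R n := [tuple - tnth x i | i < n].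
Definition vdot n (x y : euclid R n) : R := \sum_(i < n) tnth x i * tnth y i.

Lemma vsubNK n (x : euclid R n) : cancel (@vsub n ^~ x) (@vsub n ^~ (vopp x)).
Proof. by move=> y; apply: eq_from_tnth => i; rewrite !tnth_mktuple opprK subrK. Qed.

Lemma vsubK n (x : euclid R n) : cancel (@vsub n ^~ (vopp x)) (@vsub n ^~ x).
Proof. by move=> y; apply: eq_from_tnth => i; rewrite !tnth_mktuple opprK addrK. Qed.

Let shift (a : R) (x : measurableTypeR R) : measurableTypeR R := x - a.

Let measurable_shift (a : R) : measurable_fun setT (shift a).
Proof. exact: measurable_funB. Qed.

Lemma measurable_vsub n (x : euclid R n) : measurable_fun setT (@vsub n ^~ x).
Proof.
apply/measurable_fun_tnthP => i.
rewrite [X in measurable_fun _ X](_ : _ =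
  shift (tnth x i) \o (@tnth n _ ^~ i)).
  by apply: measurableT_comp; [exact: measurable_shift|exact: measurable_tnth].
by apply/funext => y /=; rewrite tnth_mktuple.
Qed.

Lemma measurable_vdot n (x : euclid R n) :
  measurable_fun [set: euclid R n] (fun y => vdot x y : measurableTypeR R).
Proof.
apply: measurable_sum => i; apply: measurable_funM => //.
exact: measurable_tnth.
Qed.

Let lebesgue_shift (a : R) (A : set (measurableTypeR R)) : measurable A ->
  lebesgue_measure (shift a @^-1` A) =
  lebesgue_measure A.
Proof.
have mf := measurable_shift a.
pose m : {measure set (measurableTypeR R) -> \bar R} :=
  pushforward lebesgue_measure (shift a).
move=> mA; apply/esym; change (lebesgue_measure A = m mf A).
apply: (@lebesgue_measure_unique R (m mf)) => // _ [[u v] _ <-].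
rewrite /m/= /pushforward.
rewrite (_ : _ @^-1` _ = `]u + a, v + a]%classic).
  rewrite !lebesgue_measure_itv/= !lte_fin ltrD2r.
  by case: ifP => // _; rewrite -!EFinB [in RHS]opprD addrACA subrr addr0.
by apply/seteqP; split => x /=; rewrite !in_itv/= ltrBrDr lerBlDr.
Qed.

Lemma lebesgue_vsub n (a : euclid R n) (A : set (euclid R n)) : measurable A ->
  lebesgue_euclid R n ((@vsub n ^~ a) @^-1` A) = lebesgue_euclid R n A.
Proof.
elim: n a A => [|n IH] a A mA.
  congr (_ _); apply/seteqP.
  by split => t /=; rewrite (tuple0 (vsub t a)) (tuple0 t).
rewrite /= /lebesgue_step /pushforward.
set B := @vcons R n @^-1` A.
have mB : measurable B.
  by rewrite -[X in measurable X]setTI; exact: measurable_vcons.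
pose a' : euclid R n := [tuple of behead a].
transitivity (\int[@lebesgue_measure R]_x
    ((lebesgue_euclid R n \o xsection B) \o
      (shift (thead a))) x)%E.
  apply: eq_integral => x _ /=.
  have mxB : measurable (xsection B (shift (thead a) x)).
    exact: measurable_xsection.
  rewrite -(IH a' _ mxB).
  congr (lebesgue_euclid R n _); apply/seteqP.
  have E t : vsub (vcons (x, t)) a = vcons (x - thead a, vsub t a').
    apply: eq_from_tnth => i; rewrite tnth_mktuple.
    case: (unliftP ord0 i) => [j ->|->]; last by rewrite !tnth0.
    rewrite !tnthS tnth_mktuple; congr (_ - _).
    by rewrite (tuple_eta a) tnthS; congr (tnth _ _); apply/val_inj.
  by split => t; rewrite /xsection /= !inE /B /= E.
have mg : measurable_fun setT (lebesgue_euclid R n \o xsection B).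
  by apply: measurable_fun_xsection.
rewrite -(@ge0_integral_pushforward _ _ _ _ _ _ (measurable_shift (thead a))
  lebesgue_measure setT) //.
apply: (@eq_measure_integral _ _ R setT lebesgue_measure) => X mX _.
exact: lebesgue_shift.
Qed.

End translation.

Section normc_facts.
Variable R : realType.
Implicit Types z w : R[i].

Lemma sqr_normcE z : normc z ^+ 2 = complex.Re z ^+ 2 + complex.Im z ^+ 2.
Proof. by case: z => a b /=; rewrite sqr_sqrtr// addr_ge0// sqr_ge0. Qed.

Lemma sqr_normcD z w : normc (z + w) ^+ 2 <= 2 * (normc z ^+ 2 + normc w ^+ 2).
Proof.
rewrite !sqr_normcE; case: z w => a b [a' b'] /=.
have := sqr_ge0 (a - a'); have := sqr_ge0 (b - b'); rewrite !sqrrB !sqrrD.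
lra.
Qed.

End normc_facts.

Section complex_L2.
Context d (T : measurableType d) (R : realType).
Variable mu : {measure set T -> \bar R}.
Implicit Types f g : T -> R[i].

Definition cmeasurable f :=
  measurable_fun setT (@complex.Re R \o f) /\
  measurable_fun setT (@complex.Im R \o f).

Definition cintegral f : R[i] :=
  (\int[mu]_x complex.Re (f x)) +i* (\int[mu]_x complex.Im (f x)).

Lemma measurable_sqr_normc f : cmeasurable f ->
  measurable_fun setT (fun x => ((normc (f x)) ^+ 2)%:E).
Proof.
move=> [mr mi]; apply/measurable_EFinP.
under eq_fun do rewrite sqr_normcE.
by apply: measurable_funD; apply: measurable_funX.
Qed.

Definition sqint : {pred T -> R[i]} :=
  [pred f | `[< cmeasurable f /\ (\int[mu]_x (normc (f x) ^+ 2)%:E < +oo)%E >]].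

Lemma sqint_submod_closed : submod_closed sqint.
Proof.
split.
  apply/asboolP; split; first by split; exact: measurable_cst.
  under eq_integral do rewrite normc0 expr0n/=.
  by rewrite integral0.
move=> a f g /asboolP[mf If] /asboolP[mg Ig]; apply/asboolP.
have mafg : cmeasurable (a *: f + g).
  case: mf => mfr mfi; case: mg => mgr mgi.
  split.
    rewrite [X in measurable_fun _ X](_ : _ = (fun x =>
       complex.Re a * complex.Re (f x) - complex.Im a * complex.Im (f x)
       + complex.Re (g x))).
      apply: measurable_funD => //; apply: measurable_funB;
      by apply: measurable_funM.
    by apply/funext => x /=; rewrite !fctE; case: (a) (f x) (g x) => ? ? [? ?] [? ?].
  rewrite [X in measurable_fun _ X](_ : _ = (fun x =>
     complex.Re a * complex.Im (f x) + complex.Im a * complex.Re (f x)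
     + complex.Im (g x))).
    apply: measurable_funD => //; apply: measurable_funD;
    by apply: measurable_funM.
  by apply/funext => x /=; rewrite !fctE; case: (a) (f x) (g x) => ? ? [? ?] [? ?].
split => //.
have a0 : 0 <= 2 * normc a ^+ 2 := mulr_ge0 (ler0n _ 2) (sqr_ge0 _).
pose F := fun x => ((2 * normc a ^+ 2)%:E * (normc (f x) ^+ 2)%:E +
                    2%:E * (normc (g x) ^+ 2)%:E)%E.
apply: (@le_lt_trans _ _ (\int[mu]_x F x)%E).
  apply: ge0_le_integral => //.
  - by move=> x _; rewrite lee_fin sqr_ge0.
  - exact: measurable_sqr_normc.
  - by apply: emeasurable_funD; apply: measurable_funeM; exact: measurable_sqr_normc.
  - move=> x _; rewrite /F -!EFinM -EFinD lee_fin (le_trans (sqr_normcD _ _))//.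
    by rewrite normcM exprMn mulrDr mulrA.
rewrite ge0_integralD//; last 4 first.
- by move=> x _; rewrite -EFinM lee_fin; exact: mulr_ge0 a0 (sqr_ge0 _).
- by apply: measurable_funeM; exact: measurable_sqr_normc.
- by move=> x _; rewrite -EFinM lee_fin; exact: mulr_ge0 (ler0n _ 2) (sqr_ge0 _).
- by apply: measurable_funeM; exact: measurable_sqr_normc.
rewrite !ge0_integralZl_EFin//;
  do ?[exact: measurable_sqr_normc | by move=> x _; rewrite lee_fin sqr_ge0].
by apply: lte_add_pinfty; apply: lte_mul_pinfty.
Qed.

HB.instance Definition _ :=
  GRing.isSubmodClosed.Build R[i] (T -> R[i]) sqint sqint_submod_closed.

Record sqfun := Sqfun { sqfun_val :> T -> R[i]; sqfunP : sqfun_val \in sqint }.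

HB.instance Definition _ := [isSub for sqfun_val].
HB.instance Definition _ := [Choice of sqfun by <:].
HB.instance Definition _ := [SubChoice_isSubLmodule of sqfun by <:].

Definition aenull : {pred sqfun} :=
  [pred f : sqfun | `[< {ae mu, forall x, f x = 0} >]].

Lemma aenull_submod_closed : submod_closed aenull.
Proof.
split; first by apply/asboolP; exact: aeW.
move=> a f g /asboolP f0 /asboolP g0; apply/asboolP.
by apply: filterS2 f0 g0 => x /= fx gx; rewrite !fctE fx gx scaler0 addr0.
Qed.

HB.instance Definition _ :=
  GRing.isSubmodClosed.Build R[i] sqfun aenull aenull_submod_closed.

(* Square-integrable complex functions modulo almost everywhere equality. *)
Definition L2 := Quotient.quot aenull.
HB.instance Definition _ := GRing.Zmodule.on L2.
HB.instance Definition _ := Quotient.on L2.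

Local Open Scope quotient_scope.

Lemma L2_eqP (f g : sqfun) :
  \pi_L2 f = \pi_L2 g <-> {ae mu, forall x, f x = g x}.
Proof.
split=> [/eqP|fg].
  rewrite -Quotient.idealrBE => /asboolP.
  by apply: filterS => x /= /eqP; rewrite subr_eq0 => /eqP.
apply/eqP; rewrite -Quotient.idealrBE; apply/asboolP.
apply: filterS fg => x fgx; change (f x - g x = 0).
by rewrite fgx subrr.
Qed.

Definition L2_scale (a : R[i]) (u : L2) : L2 := \pi_L2 (a *: repr u).

Lemma pi_L2_scale a (f : sqfun) : L2_scale a (\pi_L2 f) = \pi_L2 (a *: f).
Proof.
apply/L2_eqP; have /L2_eqP : \pi_L2 (repr (\pi_L2 f)) = \pi_L2 f by rewrite reprK.
apply: filterS => x fx.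
change (a *: (repr (\pi_L2 f) : sqfun) x = a *: f x); by rewrite fx.
Qed.

Lemma pi_L2D (f g : sqfun) : \pi_L2 (f + g) = \pi_L2 f + \pi_L2 g.
Proof. by rewrite !piE. Qed.

Let L2_scaleA a b (u : L2) : L2_scale a (L2_scale b u) = L2_scale (a * b) u.
Proof. by elim/quotW: u => f; rewrite (pi_L2_scale b) !pi_L2_scale scalerA. Qed.

Let L2_scale1 : left_id 1 L2_scale.
Proof. by elim/quotW => f; rewrite pi_L2_scale scale1r. Qed.

Let L2_scaleDr : right_distributive L2_scale +%R.
Proof.
move=> a; elim/quotW => f; elim/quotW => g.
by rewrite -pi_L2D !pi_L2_scale scalerDr pi_L2D.
Qed.

Let L2_scaleDl (v : L2) : {morph L2_scale^~ v : a b / a + b}.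
Proof. by move=> a b; elim/quotW: v => f; rewrite !pi_L2_scale scalerDl pi_L2D. Qed.

HB.instance Definition _ := GRing.Zmodule_isLmodule.Build R[i] L2
  L2_scaleA L2_scale1 L2_scaleDr L2_scaleDl.

Lemma pi_L2Z a (f : sqfun) : a *: (\pi_L2 f : L2) = \pi_L2 (a *: f).
Proof. exact: pi_L2_scale. Qed.

Definition inner (u v : L2) : R[i] :=
  cintegral (fun x => repr u x * (repr v x)^*).

Definition L2norm (u : L2) : R := Num.sqrt (complex.Re (inner u u)).

Lemma cmeasurableM f g : cmeasurable f -> cmeasurable g ->
  cmeasurable (fun x => f x * (g x)^*).
Proof.
move=> [mfr mfi] [mgr mgi]; split.
  rewrite [X in measurable_fun _ X](_ : _ = (fun x =>
     complex.Re (f x) * complex.Re (g x) + complex.Im (f x) * complex.Im (g x))).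
    by apply: measurable_funD; apply: measurable_funM.
  by apply/funext => x /=; case: (f x) (g x) => ? ? [? ?] /=; rewrite mulrN opprK.
rewrite [X in measurable_fun _ X](_ : _ = (fun x =>
   complex.Im (f x) * complex.Re (g x) - complex.Re (f x) * complex.Im (g x))).
  by apply: measurable_funB; apply: measurable_funM.
by apply/funext => x /=; case: (f x) (g x) => ? ? [? ?] /=; rewrite mulrN addrC.
Qed.

Lemma sqfun_measurable (f : sqfun) : cmeasurable f.
Proof. by have /asboolP[] := sqfunP f. Qed.

Lemma ae_eq_cintegral f g : cmeasurable f -> cmeasurable g ->
  {ae mu, forall x, f x = g x} -> cintegral f = cintegral g.
Proof.
move=> [mfr mfi] [mgr mgi] fg; rewrite /cintegral /Rintegral.
congr (fine _ +i* fine _); apply: ae_eq_integral => //; do ?exact/measurable_EFinP.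
  by apply: filterS fg => x /= ->.
by apply: filterS fg => x /= ->.
Qed.

Lemma ae_repr_pi (f : sqfun) : {ae mu, forall x, repr (\pi_L2 f) x = f x}.
Proof. by apply/L2_eqP; rewrite reprK. Qed.

Lemma inner_pi (f g : sqfun) :
  inner (\pi_L2 f) (\pi_L2 g) = cintegral (fun x => f x * (g x)^*).
Proof.
apply: ae_eq_cintegral; do ?[apply: cmeasurableM; exact: sqfun_measurable].
by apply: filterS2 (ae_repr_pi f) (ae_repr_pi g) => x /= -> ->.
Qed.

End complex_L2.

Notation L2euclid R d := (L2 (lebesgue_euclid R d)).

Section time_frequency.
Variables (R : realType) (d : nat).
Local Notation E := (euclid R d).
Local Notation leb := (lebesgue_euclid R d).
Local Notation H := (L2euclid R d).
Implicit Types (x y xi : E) (z : E * E).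
Local Open Scope quotient_scope.

Definition cis (t : R) : R[i] := cos t +i* sin t.

Definition tfshift_fun z (f : E -> R[i]) (y : E) : R[i] :=
  cis (2 * trigo.pi * vdot z.2 y) * f (vsub y z.1).

Lemma integral_vsub x (F : E -> \bar R) : measurable_fun setT F ->
  (\int[leb]_y F (vsub y x) = \int[leb]_y F y)%E.
Proof.
have mx := @measurable_vsub R d x.
have H0 (G : E -> \bar R) : measurable_fun setT G -> (forall y, 0 <= G y)%E ->
    (\int[leb]_y G (vsub y x) = \int[leb]_y G y)%E.
  move=> mG G0.
  rewrite -[LHS](@ge0_integral_pushforward _ _ _ _ _ _ mx leb setT G) //.
  apply: (@eq_measure_integral _ _ R setT leb) => A mA _.
  exact: lebesgue_vsub.
move=> mF; rewrite [LHS]integralE [RHS]integralE.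
congr (_ - _)%E.
  transitivity (\int[leb]_y F^\+%E (vsub y x))%E.
    by apply: eq_integral => y _; rewrite !funeposE.
  exact: (H0 _ (measurable_funepos mF) (funepos_ge0 F)).
transitivity (\int[leb]_y F^\-%E (vsub y x))%E.
  by apply: eq_integral => y _; rewrite !funenegE.
exact: (H0 _ (measurable_funeneg mF) (funeneg_ge0 F)).
Qed.

Lemma cintegral_vsub x (F : E -> R[i]) : cmeasurable F ->
  cintegral leb (fun y => F (vsub y x)) = cintegral leb F.
Proof.
move=> [mr mi]; rewrite /cintegral /Rintegral.
rewrite (integral_vsub x (F := fun y => (complex.Re (F y))%:E)); last exact/measurable_EFinP.
by rewrite (integral_vsub x (F := fun y => (complex.Im (F y))%:E)); last exact/measurable_EFinP.
Qed.

Lemma cmeasurable_tfshift z (f : E -> R[i]) :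
  cmeasurable f -> cmeasurable (tfshift_fun z f).
Proof.
move=> [mr mi].
have mt : measurable_fun setT (fun y : E => 2 * trigo.pi * vdot z.2 y : R).
  by apply: measurable_funM => //; exact: measurable_vdot.
have mc : measurable_fun setT (fun y : E => cos (2 * trigo.pi * vdot z.2 y) : R).
  apply: (measurableT_comp _ mt); apply: continuous_measurable_fun.
  exact: continuous_cos.
have ms : measurable_fun setT (fun y : E => sin (2 * trigo.pi * vdot z.2 y) : R).
  apply: (measurableT_comp _ mt); apply: continuous_measurable_fun.
  exact: continuous_sin.
have mx := @measurable_vsub R d z.1.
have mrx : measurable_fun setT (fun y : E => complex.Re (f (vsub y z.1)) : R).
  exact: (measurableT_comp mr mx).
have mix : measurable_fun setT (fun y : E => complex.Im (f (vsub y z.1)) : R).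
  exact: (measurableT_comp mi mx).
split.
  rewrite [X in measurable_fun _ X](_ : _ = (fun y : E =>
     cos (2 * trigo.pi * vdot z.2 y) * complex.Re (f (vsub y z.1))
     - sin (2 * trigo.pi * vdot z.2 y) * complex.Im (f (vsub y z.1)))).
    by apply: measurable_funB; exact: measurable_funM.
  by apply/funext => y /=; rewrite /tfshift_fun; case: (f _).
rewrite [X in measurable_fun _ X](_ : _ = (fun y : E =>
   cos (2 * trigo.pi * vdot z.2 y) * complex.Im (f (vsub y z.1))
   + sin (2 * trigo.pi * vdot z.2 y) * complex.Re (f (vsub y z.1)))).
  by apply: measurable_funD; exact: measurable_funM.
by apply/funext => y /=; rewrite /tfshift_fun; case: (f _).
Qed.

Lemma normc_cis t : normc (cis t) = 1.
Proof. by rewrite /= cos2Dsin2 sqrtr1. Qed.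

Lemma tfshift_sqint z (f : sqfun leb) : tfshift_fun z f \in sqint leb.
Proof.
have mf := sqfun_measurable f; have /asboolP[_ If] := sqfunP f.
apply/asboolP; split; first exact: cmeasurable_tfshift.
under eq_integral do rewrite normcM normc_cis mul1r.
rewrite (integral_vsub z.1 (F := fun y => (normc (f y) ^+ 2)%:E)) //.
exact: measurable_sqr_normc.
Qed.

Definition tfshift_sqfun z (f : sqfun leb) : sqfun leb :=
  Sqfun (tfshift_sqint z f).

Definition tfshift z (u : H) : H := \pi_(L2 leb) (tfshift_sqfun z (repr u)).

Lemma ae_vsub x (P : E -> Prop) :
  {ae leb, forall y, P y} -> {ae leb, forall y, P (vsub y x)}.
Proof.
have mx := @measurable_vsub R d x.
move=> [N [mN N0 PN]]; exists ((@vsub R d)^~ x @^-1` N); split.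
- by rewrite -[X in measurable X]setTI; exact: mx.
- by rewrite lebesgue_vsub.
- by move=> y /= Py; exact: PN.
Qed.

Lemma tfshift_pi z (f : sqfun leb) :
  tfshift z (\pi_(L2 leb) f) = \pi_(L2 leb) (tfshift_sqfun z f).
Proof.
apply/L2_eqP; have := ae_vsub z.1 (ae_repr_pi f).
by apply: filterS => y /= fy; rewrite /tfshift_fun fy.
Qed.

Definition is_adjoint (A B : H -> H) := forall u v, inner (A u) v = inner u (B v).

(* On a Hilbert space the B satisfying is_adjoint A B is unique; that it exists
   for the time-frequency shifts is adjoint_tfshiftP below. *)
Definition adjoint (A : H -> H) : H -> H := xget (fun=> 0) [set B | is_adjoint A B].

Definition tfshift_inv z (u : H) : H :=
  cis (- (2 * trigo.pi * vdot z.1 z.2)) *: tfshift (vopp z.1, vopp z.2) u.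

Lemma vdotC x y : vdot x y = vdot y x.
Proof. by apply: eq_bigr => i _; rewrite mulrC. Qed.

Lemma vdotB x y xi : vdot xi (vsub y x) = vdot xi y - vdot xi x.
Proof.
by rewrite /vdot -sumrB; apply: eq_bigr => i _; rewrite tnth_mktuple mulrBr.
Qed.

Lemma vdotNl x y : vdot (vopp x) y = - vdot x y.
Proof.
by rewrite /vdot -sumrN; apply: eq_bigr => i _; rewrite tnth_mktuple mulNr.
Qed.

Lemma cisD s t : cis (s + t) = cis s * cis t.
Proof. by rewrite /cis cosD sinD; congr (_ +i* _); rewrite addrC. Qed.

Lemma conj_cis t : (cis t)^* = cis (- t).
Proof. by rewrite /cis cosN sinN. Qed.

Lemma tfshift_adjoint z : is_adjoint (tfshift z) (tfshift_inv z).
Proof.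
elim/quotW => f; elim/quotW => g; rewrite /tfshift_inv !tfshift_pi pi_L2Z.
rewrite !inner_pi.
set g' := _ *: _.
rewrite -[RHS](@cintegral_vsub z.1); last first.
  by apply: cmeasurableM; exact: sqfun_measurable.
congr cintegral; apply/funext => y.
rewrite (_ : g' (vsub y z.1) = cis (- (2 * trigo.pi * vdot z.2 y)) * g y); last first.
  change (cis (- (2 * trigo.pi * vdot z.1 z.2)) *
    (cis (2 * trigo.pi * vdot (vopp z.2) (vsub y z.1)) *
     g (vsub (vsub y z.1) (vopp z.1))) = cis (- (2 * trigo.pi * vdot z.2 y)) * g y).
  rewrite vsubNK mulrA -cisD; congr (cis _ * _).
  by rewrite vdotNl vdotB (vdotC z.1); ring.
by rewrite rmorphM/= conj_cis opprK /tfshift_fun; ring.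
Qed.

Lemma adjoint_tfshiftP z : is_adjoint (tfshift z) (adjoint (tfshift z)).
Proof. by rewrite /adjoint; case: xgetP => [B _ //|/(_ _ (tfshift_adjoint z))]. Qed.

Definition alpha z (S : H -> H) : H -> H := tfshift z \o S \o adjoint (tfshift z).

Definition Qsym (S : H -> H) (f : H) z : R[i] := inner (alpha z S f) f.

Definition bounded_op (S : H -> H) :=
  exists M : R, forall f, L2norm (S f) <= M * L2norm f.

(* The suprema below are taken in the extended reals. *)
Definition numerical_radius (S : H -> H) : \bar R :=
  ereal_sup [set (normc (inner (S g) g))%:E | g in [set g | L2norm g = 1]].

(* R^(2d) is R^d * R^d with the Lebesgue-measurable sets, i.e. the Caratheodory
   measurable sets of the outer measure induced by the product measure. *)
Definition phase := caratheodory_type ((leb \x leb)%E^*)%mu.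
HB.instance Definition _ := Measurable.on phase.

Definition lebesgue_phase : set phase -> \bar R :=
  @completed_measure_extension _ _ R (leb \x leb)%E.
HB.instance Definition _ := Measure.on lebesgue_phase.

Definition Linfty_norm (Omega : set phase) (mOmega : measurable Omega)
    (F : phase -> R[i]) : \bar R :=
  Lnorm (mrestr lebesgue_phase mOmega) +oo%E (fun z => (normc (F z))%:E).

Definition Lambda_infty (Omega : set phase) (mOmega : measurable Omega)
    (S : H -> H) : \bar R :=
  ereal_sup [set (Linfty_norm mOmega (Qsym S f) / (L2norm f ^+ 2)%:E)%E
            | f in [set f : H | f != 0]].

End time_frequency.

(* Main.v *)
(* Since pi(z) is unitary, |Q_S f(z)| = |<S h, h>| for h = pi(z)^* f, a vector
   of norm ||f||; this bounds Lambda_infty by w(S).  Conversely, given a unit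
   vector g, we look for z0 such that f = pi(z0) g has ess sup over Omega of
   |Q_S f| at least |<S g, g>|.  This needs neither continuity of translations
   nor Lebesgue density: L^2 is separable, so for each k the orbit
   {pi(z) g} is covered by countably many sets of diameter at most 1/(k+1), and
   countably many negligible preimages cannot exhaust Omega.  Hence some z0 lies
   in no negligible preimage, so for every e > 0 the points z of Omega with
   ||pi(z) g - pi(z0) g|| <= e are not negligible, and there pi(z)^* f is within
   e of g. *)
Require Import Defs.
From mathcomp Require Import all_boot all_order all_algebra complex.
From mathcomp Require Import all_classical all_reals all_analysis.
From mathcomp Require Import ess_sup_inf measurable_realfun generic_quotient ring lra.
Set Implicit Arguments.
Unset Strict Implicit.
Unset Printing Implicit Defensive.
Import Order.TTheory GRing.Theory Num.Theory.
Import numFieldNormedType.Exports.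
Import ComplexField.Normc HBNNSimple.
Local Open Scope classical_set_scope.
Local Open Scope ring_scope.

(** * Approximation of measurable sets by a countable algebra *)

Lemma cvge0_exists_lt (R : realType) (u : (\bar R)^nat) (e : R) :
  (forall n, 0 <= u n)%E -> u @ \oo --> 0%:E -> 0 < e ->
  exists n, (u n < e%:E)%E.
Proof.
move=> u0 /fine_cvgP[fu /cvgrPdist_lt cu] e0; near \oo => n; exists n.
have fun_ : u n \is a fin_num by near: n.
rewrite -(fineK fun_) lte_fin -[ltLHS]ger0_norm ?fine_ge0//.
have : `|0 - (fine \o u) n| < e by near: n; exact: cu.
by rewrite sub0r normrN.
Unshelve. all: by end_near. Qed.

Section countable_algebra.
Context d (T : measurableType d) (R : realType) (I : countType).
Variable G : I -> set T.
Hypothesis mG : forall i, measurable (G i).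
Implicit Types t : GenTree.tree I.

(* A node is the complement of the union of its children; such sets are closed
   under all boolean operations and, unlike sets, the trees form a countType. *)
Fixpoint gen_algebra t : set T :=
  match t with
  | GenTree.Leaf i => G i
  | GenTree.Node _ ts => ~` foldr (fun t A => gen_algebra t `|` A) set0 ts
  end.

Lemma measurable_gen_algebra t : measurable (gen_algebra t).
Proof.
(* Trees nest through lists, so the recursion on trees is explicit, with an inner induction on the
   list of children. *)
move: t; fix IH 1 => -[i|k ts] /=; first exact: mG.
apply: measurableC; elim: ts => [|t ts IHts] /=; first exact: measurable0.
by apply: measurableU.
Qed.

Variables (mu : {measure set T -> \bar R}) (F : set T).
Hypotheses (mF : measurable F) (Foo : (mu F < +oo)%E).

(** The error is measured inside [F], of finite measure, so that continuity from above applies to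
    decreasing remainders. *)
Definition gen_approximable (B : set T) := measurable B /\
  forall e : R, 0 < e -> exists t, (mu (F `&` (B `+` gen_algebra t)) < e%:E)%E.

Let mS (A B : set T) : measurable A -> measurable B ->
  measurable (F `&` (A `+` B)).
Proof.
move=> mA mB; apply: measurableI => //.
by rewrite setY_def; apply: measurableU; exact: measurableD.
Qed.

Let setYCC (A B : set T) : ~` A `+` ~` B = A `+` B.
Proof. by rewrite !setY_def !setDE !setCK setUC (setIC B) setIC. Qed.

Lemma gen_approximableC B : gen_approximable B -> gen_approximable (~` B).
Proof.
move=> [mB aB]; split; first exact: measurableC.
move=> e /aB[t te]; exists (GenTree.Node 0 [:: t]) => /=.
by rewrite setU0 setYCC.
Qed.

(** Triangle inequality for the symmetric difference, with [e / 2] for each distance. *)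
Lemma gen_approximable_near B : measurable B ->
  (forall e : R, 0 < e -> exists2 A, gen_approximable A &
     (mu (F `&` (B `+` A)) < e%:E)%E) -> gen_approximable B.
Proof.
move=> mB aB; split=> // e e0.
have e20 : 0 < e / 2 by rewrite divr_gt0.
have [A [mA /(_ _ e20)[t At] BA]] := aB _ e20; exists t.
have mt := measurable_gen_algebra t.
rewrite [e]splitr EFinD; apply: le_lt_trans (lteD BA At).
apply: le_trans (measureU2 mu (mS mB mA) (mS mA mt)).
apply: le_measure; rewrite ?inE; first exact: mS.
  by apply: measurableU; exact: mS.
rewrite !setY_def => x [Fx []] [Px Qx] /=; have [Ax|Ax] := pselect (A x);
by [left; split=> //; (left + right)|right; split=> //; (left + right)].
Qed.

Lemma gen_approximableU A B :
  gen_approximable A -> gen_approximable B -> gen_approximable (A `|` B).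
Proof.
move=> [mA aA] [mB aB]; split; first exact: measurableU.
move=> e e0; have e20 : 0 < e / 2 by rewrite divr_gt0.
have [t tA] := aA _ e20; have [u uB] := aB _ e20.
(* The inner node is the complement of the union, and the outer node complements it back. *)
exists (GenTree.Node 0 [:: GenTree.Node 0 [:: t; u]]) => /=.
rewrite !setU0 setCK.
have mt := measurable_gen_algebra t; have mu' := measurable_gen_algebra u.
rewrite [e]splitr EFinD; apply: le_lt_trans (lteD tA uB).
apply: le_trans (measureU2 mu (mS mA mt) (mS mB mu')).
apply: le_measure; rewrite ?inE.
- by apply: mS; exact: measurableU.
- by apply: measurableU; exact: mS.
rewrite !setY_def => x [Fx [[[Px|Px] Q]|[[Px|Px] Q]]];
  by [left; split=> //; (left + right); split=> // ?; apply: Q; (left + right)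
     |right; split=> //; (left + right); split=> // ?; apply: Q; (left + right)].
Qed.

Lemma gen_approximable0 : gen_approximable set0.
Proof.
split; first exact: measurable0.
move=> e e0; exists (GenTree.Node 0 [:: GenTree.Node 0 [::]]) => /=.
by rewrite setU0 setCK setY0 setI0 measure0 lte_fin.
Qed.

(** The finite unions [C n] are approximable, and what they miss inside [F] decreases to the empty
    set; since [mu F] is finite, its measure tends to 0. *)
Lemma gen_approximable_bigcup (A : (set T)^nat) :
  (forall n, gen_approximable (A n)) -> gen_approximable (\bigcup_n A n).
Proof.
move=> aA; have mA n : measurable (A n) by have [] := aA n.
have mB : measurable (\bigcup_n A n) by exact: bigcup_measurable.
apply: gen_approximable_near => // e e0.
pose C n := \big[setU/set0]_(i < n) A i.
have aC n : gen_approximable (C n).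
  rewrite /C; elim/big_ind: _ => //; first exact: gen_approximable0.
  by move=> *; exact: gen_approximableU.
have mC n : measurable (C n) by have [] := aC n.
have CB n : C n `<=` \bigcup_n A n.
  by rewrite /C -bigcup_mkord => x [i _ Aix]; exists i.
pose D n := F `&` (\bigcup_n A n `\` C n).
have mD n : measurable (D n).
  by apply: measurableI => //; exact: measurableD.
have D0 : \bigcap_n D n = set0.
  rewrite -subset0 => x DX; have [_ [[n _ Anx] _]] := DX 0%N Logic.I.
  (* [A n] enters the partial unions at index [n.+1]. *)
  have [_ [_]] := DX n.+1 Logic.I; apply.
  by rewrite /C -bigcup_mkord; exists n => /=.
have [||n Dn] := @cvge0_exists_lt R (mu \o D) e _ _ e0.
- by move=> n; exact: measure_ge0.
- rewrite (_ : 0%:E = mu (\bigcap_n D n)); last by rewrite D0 measure0.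
  apply: nonincreasing_cvg_mu => //.
  + apply: le_lt_trans Foo; apply: le_measure; rewrite ?inE//.
    by move=> x [].
  + by rewrite D0.
  + move=> m n mn; apply/subsetPset => x [Fx [Bx Cx]]; split=> //; split=> //.
    apply: contra_not Cx; rewrite /C -!bigcup_mkord => -[i im Aix].
    by exists i => //=; exact: leq_trans im mn.
exists (C n) => //; rewrite (_ : F `&` _ = D n)//.
by rewrite /D setY_def; congr (_ `&` _); apply/setUidPl => x [/CB Cx].
Qed.

Lemma sigma_algebra_gen_approximable : sigma_algebra setT gen_approximable.
Proof.
split; [exact: gen_approximable0| |exact: gen_approximable_bigcup].
by move=> A; rewrite setTD; exact: gen_approximableC.
Qed.

(** The approximable sets form a sigma-algebra containing every [G i], hence the one generated by
    them. *)
Lemma gen_algebra_dense B : <<s range G >> B -> forall e : R, 0 < e ->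
  exists t, (mu (F `&` (B `+` gen_algebra t)) < e%:E)%E.
Proof.
move=> GB; suff [] : gen_approximable B by [].
apply: GB; split; first exact: sigma_algebra_gen_approximable.
move=> _ [i _ <-]; split; first exact: mG.
by move=> e e0; exists (GenTree.Leaf i); rewrite /= setYK setI0 measure0 lte_fin.
Qed.

End countable_algebra.

(** * Square integrals of real functions *)

Section real_square_integral.
Context d (T : measurableType d) (R : realType).
Variable mu : {measure set T -> \bar R}.
Implicit Types f g h : T -> R.

Definition sqintegral h : \bar R := (\int[mu]_x (h x ^+ 2)%:E)%E.

Let msq h : measurable_fun setT h ->
  measurable_fun setT (fun x => (h x ^+ 2)%:E).
Proof. by move=> mh; apply/measurable_EFinP; exact: measurable_funX. Qed.

Lemma sqintegral_ge0 h : (0 <= sqintegral h)%E.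
Proof. by apply: integral_ge0 => x _; rewrite lee_fin sqr_ge0. Qed.

(** Integrates (a + b)^2 <= 2 (a^2 + b^2), that is (a - b)^2 >= 0. It stands in for Minkowski's
    inequality, as the constant is harmless for density. *)
Lemma le_sqintegralD f g : measurable_fun setT f -> measurable_fun setT g ->
  (sqintegral (f \+ g)%R <= 2%:E * (sqintegral f + sqintegral g))%E.
Proof.
move=> mf mg; rewrite /sqintegral -ge0_integralD//; last 4 first.
- by move=> x _; rewrite lee_fin sqr_ge0.
- exact: msq.
- by move=> x _; rewrite lee_fin sqr_ge0.
- exact: msq.
rewrite -ge0_integralZl//; last 2 first.
- by apply: emeasurable_funD; exact: msq.
- by move=> x _; rewrite -EFinD lee_fin addr_ge0// sqr_ge0.
apply: ge0_le_integral => //.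
- by move=> x _; rewrite lee_fin sqr_ge0.
- by apply: msq; exact: measurable_funD.
- by apply: measurable_funeM; apply: emeasurable_funD; exact: msq.
- move=> x _; rewrite -EFinD -EFinM lee_fin.
  by have := sqr_ge0 (f x - g x); rewrite sqrrB sqrrD; lra.
Qed.

Lemma sqintegralZ_indic (c : R) (A : set T) : measurable A ->
  sqintegral (fun x => c * \1_A x) = ((c ^+ 2)%:E * mu A)%E.
Proof.
move=> mA; rewrite -(setIT A) -integral_indic// setIT -ge0_integralZl//.
- apply: eq_integral => x _; rewrite -EFinM exprMn; congr (_ * _)%:E.
  by rewrite indicE; case: (x \in A); rewrite ?expr1n ?expr0n.
- exact/measurable_EFinP/measurable_indic.
- by rewrite lee_fin sqr_ge0.
Qed.

End real_square_integral.

(** * Density of countably many step functions in real L^2 *)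

Section step_sum.
Context d (T : measurableType d) (R : realType) (I : countType).
Variables (mu : {measure set T -> \bar R}) (G : I -> set T) (F : (set T)^nat).
Hypotheses (mG : forall i, measurable (G i))
  (GT : @measurable d T `<=` <<s range G >>)
  (mF : forall n, measurable (F n)) (Foo : forall n, (mu (F n) < +oo)%E)
  (ndF : nondecreasing_seq F) (FT : \bigcup_n F n = setT).
Implicit Types h : T -> R.

(** The codes are finite lists over a countable type, so only countably many functions arise; this
    is the source of separability. *)
Definition step_sum (s : seq (rat * nat * GenTree.tree I)) : T -> R :=
  fun x => \sum_(p <- s) ratr p.1.1 * \1_(gen_algebra G p.2 `&` F p.1.2) x.

Lemma measurable_step_sum s : measurable_fun setT (step_sum s).
Proof.
apply: measurable_sum => p; apply: measurable_funM => //.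
apply: measurable_indic; apply: measurableI => //.
exact: measurable_gen_algebra.
Qed.

Definition step_approximable h := measurable_fun setT h /\
  forall e : R, 0 < e -> exists s, (sqintegral mu (h \- step_sum s)%R < e%:E)%E.

(** The quarters absorb the factor of [le_sqintegralD]: 2 (e/4 + e/4) = e. *)
Lemma sqintegralD_lt f g (e : R) : measurable_fun setT f ->
  measurable_fun setT g -> (sqintegral mu f < (e / 4)%:E)%E ->
  (sqintegral mu g < (e / 4)%:E)%E -> (sqintegral mu (f \+ g)%R < e%:E)%E.
Proof.
move=> mf mg fe ge; apply: le_lt_trans (le_sqintegralD mu mf mg) _.
rewrite (_ : e%:E = 2%:E * ((e / 4)%:E + (e / 4)%:E))%E; last first.
  by rewrite -EFinD -EFinM; congr (_%:E); field.
by rewrite lte_pmul2l// lteD.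
Qed.

Lemma step_approximableD f g :
  step_approximable f -> step_approximable g -> step_approximable (f \+ g).
Proof.
move=> [mf af] [mg ag]; split; first exact: measurable_funD.
move=> e e0; have e40 : 0 < e / 4 by rewrite divr_gt0.
have [s fs] := af _ e40; have [t gt] := ag _ e40; exists (s ++ t).
rewrite (_ : _ \- _ = (f \- step_sum s) \+ (g \- step_sum t)).
  by apply: sqintegralD_lt => //; apply: measurable_funB => //;
    exact: measurable_step_sum.
apply/funext => x /=; rewrite /step_sum big_cat /=; ring.
Qed.

Lemma step_approximable_near h : measurable_fun setT h ->
  (forall e : R, 0 < e -> exists2 g, step_approximable g &
     (sqintegral mu (h \- g)%R < e%:E)%E) -> step_approximable h.
Proof.
move=> mh ah; split=> // e e0; have e40 : 0 < e / 4 by rewrite divr_gt0.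
have [g [mg /(_ _ e40)[s gs]] hg] := ah _ e40; exists s.
rewrite (_ : _ \- _ = (h \- g) \+ (g \- step_sum s)).
  apply: sqintegralD_lt => //; apply: measurable_funB => //.
  exact: measurable_step_sum.
by apply/funext => x /=; ring.
Qed.

Lemma step_approximable0 : step_approximable (cst 0).
Proof.
split=> [|e e0]; first exact: measurable_cst.
exists [::]; rewrite /sqintegral (eq_integral (cst 0%E)).
  by rewrite integral0 lte_fin.
by move=> x _; rewrite /step_sum /= big_nil subr0 expr0n.
Qed.

(** First [c] is replaced by a rational q, then [B] by an algebra set A: on [F n] the error is (c -
    q) 1_B + q (1_B - 1_A), and each summand gets a quarter of [e]. *)
Lemma step_approximable_indic (c : R) n (B : set T) : measurable B ->
  step_approximable (fun x => c * \1_(B `&` F n) x).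
Proof.
move=> mB; have mBn : measurable (B `&` F n) by exact: measurableI.
have mcB (r : R) : measurable_fun setT (fun x => r * \1_(B `&` F n) x).
  by apply: measurable_funM => //; exact: measurable_indic.
split=> // e e0; have e40 : 0 < e / 4 by rewrite divr_gt0.
have fF : mu (F n) \is a fin_num by rewrite ge0_fin_numE.
set m := fine (mu (F n)).
have m0 : 0 <= m by exact: fine_ge0.
have [q qc] : exists q : rat, (c - ratr q) ^+ 2 * m < e / 4.
  (* [dl <= 1] turns |c - q| < dl into (c - q)^2 <= dl; [m + 1] keeps the denominator positive when
     [F n] is null. *)
  pose dl := Num.min 1 (e / 4 / (m + 1)).
  have dl0 : 0 < dl by rewrite lt_min ltr01 divr_gt0// ltr_wpDl.
  have [|q] := @rat_in_itvoo R c (c + dl); first by rewrite ltrDl.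
  rewrite in_itv/= => /andP[cq qc]; exists q.
  have dl1 : dl <= 1 by rewrite ge_min lexx.
  have dle : dl * (m + 1) <= e / 4.
    by rewrite -ler_pdivlMr ?ltr_wpDl// ge_min lexx orbT.
  have H : (c - ratr q) ^+ 2 <= dl by rewrite -sqrrN opprB expr2; nra.
  by have := ler_wpM2r m0 H; lra.
have [t tq] : exists t, ((ratr q ^+ 2)%:E *
    mu (F n `&` (B `+` gen_algebra G t)) < (e / 4)%:E)%E.
  (* A division by this factor follows, and q may be 0, hence the added 1. *)
  have q1 : 0 < (ratr q : R) ^+ 2 + 1 by rewrite ltr_wpDl// sqr_ge0.
  have [t Bt] := gen_algebra_dense mG (mF n) (Foo n) (GT mB) (divr_gt0 e40 q1).
  exists t; apply: (@le_lt_trans _ _ ((ratr q ^+ 2 + 1)%:E *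
      mu (F n `&` (B `+` gen_algebra G t)))%E).
    by rewrite lee_wpmul2r// lee_fin lerDl.
  by rewrite -lte_pdivlMl// muleC -EFinM mulrC [in ltRHS]mulrC in Bt *.
exists [:: (q, n, t)].
have mt : measurable (gen_algebra G t) by exact: measurable_gen_algebra.
rewrite (_ : _ \- _ = (fun x => (c - ratr q) * \1_(B `&` F n) x) \+
  (fun x => ratr q * (\1_(B `&` F n) x - \1_(gen_algebra G t `&` F n) x))).
  apply: sqintegralD_lt.
  - by apply: measurable_funM => //; exact: measurable_indic.
  - apply: measurable_funM => //; apply: measurable_funB;
      by apply: measurable_indic; try exact: measurableI.
  - rewrite sqintegralZ_indic//; apply: le_lt_trans (_ : (_ <= ((c - ratr q) ^+ 2 * m)%:E)%E) _.
      rewrite [leRHS]EFinM /m fineK// lee_wpmul2l ?lee_fin ?sqr_ge0//.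
      by apply: le_measure; rewrite ?inE.
    by rewrite lte_fin.
  (* The difference of the two indicators squares to the indicator of the symmetric difference
     within [F n]. *)
  - rewrite [X in (X < _)%E](_ : _ = sqintegral mu (fun x => ratr q *
      \1_(F n `&` (B `+` gen_algebra G t)) x)).
      rewrite sqintegralZ_indic//; apply: measurableI => //.
      by rewrite setY_def; apply: measurableU; exact: measurableD.
    apply: eq_integral => x _; congr (_%:E); rewrite !exprMn; congr (_ * _).
    rewrite !indicE setY_def !in_setI in_setU !in_setD.
    by case: (x \in B); case: (x \in F n); case: (x \in gen_algebra G t);
      rewrite /= ?subrr ?subr0 ?sub0r ?sqrrN.
by apply/funext => x /=; rewrite /step_sum big_seq1/=; ring.
Qed.

Lemma step_approximable_nnsfun (phi : {nnsfun T >-> R}) n :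
  step_approximable (fun x => phi x * \1_(F n) x).
Proof.
have -> : (fun x => phi x * \1_(F n) x) = (fun x =>
    \sum_(y <- finmap.enum_fset (fset_set (range phi))) y * \1_(phi @^-1` [set y] `&` F n) x).
  apply/funext => x; rewrite fimfunE fsbig_finite//= mulr_suml.
  by apply: eq_bigr => y _; rewrite indicI mulrA.
elim: (finmap.enum_fset _) => [|y s IHs].
  rewrite (_ : (fun=> _) = cst 0); first exact: step_approximable0.
  by apply/funext => x; rewrite big_nil.
rewrite (_ : (fun=> _) = (fun x => y * \1_(phi @^-1` [set y] `&` F n) x) \+
  (fun x => \sum_(y <- s) y * \1_(phi @^-1` [set y] `&` F n) x)).
  by apply: step_approximableD => //; exact: step_approximable_indic.
by apply/funext => x; rewrite big_cons.
Qed.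

(** Simple functions increasing to [h] are cut off to [F n]; the squared errors tend to 0 pointwise
    and are dominated by h^2, so dominated convergence applies. *)
Lemma step_approximable_ge0 h : measurable_fun setT h ->
  (forall x, 0 <= h x) -> (sqintegral mu h < +oo)%E -> step_approximable h.
Proof.
move=> mh h0 hoo; apply: step_approximable_near => // e e0.
have mEh : measurable_fun setT (EFin \o h) by exact/measurable_EFinP.
pose phi n := nnsfun_approx measurableT mEh n.
have cphi x : (fun n => phi n x) @ \oo --> h x.
  by have /fine_cvgP[] := cvg_nnsfun_approx measurableT mEh
    (fun x _ => h0 x) (x := x) Logic.I.
have lephi n x : phi n x <= h x.
  rewrite -(cvg_lim (@Rhausdorff R) (cphi x)).
  apply: nondecreasing_cvgn_le; last by apply/cvg_ex; exists (h x).
  by move=> m k mk; exact/lefP/nd_nnsfun_approx.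
have mphi n : measurable_fun setT (fun x => phi n x * \1_(F n) x).
  by have [] := step_approximable_nnsfun (phi n) n.
have phi0 n x : 0 <= phi n x * \1_(F n) x.
  by rewrite mulr_ge0// fun_ge0.
have phih n x : phi n x * \1_(F n) x <= h x.
  by rewrite indicE; case: (x \in F n); rewrite ?mulr1// mulr0.
pose D n x := ((h x - phi n x * \1_(F n) x) ^+ 2)%:E.
have mD n : measurable_fun setT (D n).
  by apply/measurable_EFinP/measurable_funX; exact: measurable_funB.
have [||n Dn] := @cvge0_exists_lt R (fun n => \int[mu]_x D n x)%E e _ _ e0.
- by move=> n; exact: sqintegral_ge0.
- rewrite (_ : 0%:E = \int[mu]_x (cst 0%:E x))%E; last by rewrite integral0.
  apply: (@dominated_cvg _ _ _ _ _ measurableT D _ (fun x => (h x ^+ 2)%:E)).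
  + by [].
  + move=> x _; apply: cvg_EFin; first exact: nearW.
    rewrite (_ : 0 = (h x - h x * 1) ^+ 2); last by rewrite mulr1 subrr expr0n.
    (* The [F n] increase to the whole space, so the cut-off is eventually 1 at [x]. *)
    have [k _ Fkx] : (\bigcup_n F n) x by rewrite FT.
    have c1 : (\1_(F n) x : R) @[n --> \oo] --> (1 : R).
      apply: cvg_near_cst; near=> n; rewrite indicE mem_set//.
      have kn : (k <= n)%N by near: n; exact: nbhs_infty_ge.
      by move: x Fkx; apply/subsetPset/ndF.
    change ((h x - phi n x * \1_(F n) x) ^+ 2 @[n --> \oo] -->
      (h x - h x * 1) ^+ 2).
    have cD : h x - phi n x * \1_(F n) x @[n --> \oo] --> h x - h x * 1.
      by apply: cvgB; [exact: cvg_cst|exact: cvgM].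
    exact: (cvg_comp _ _ cD (@exprn_continuous R 2 _)).
  + by [].
  + apply/integrableP; split; first by apply/measurable_EFinP/measurable_funX.
    by under eq_integral do rewrite gee0_abs ?lee_fin ?sqr_ge0//.
  + move=> n x _; rewrite gee0_abs ?lee_fin ?sqr_ge0//.
    by rewrite ler_pXn2r ?nnegrE// ?subr_ge0// gerBl.
by exists (fun x => phi n x * \1_(F n) x) => //; exact: step_approximable_nnsfun.
Unshelve. all: by end_near. Qed.

Lemma step_approximableN h : step_approximable h -> step_approximable (\- h).
Proof.
move=> [mh ah]; split; first exact: measurableT_comp.
move=> e /ah[s hs]; exists [seq (- p.1.1, p.1.2, p.2) | p <- s].
rewrite (_ : sqintegral _ _ = sqintegral mu (h \- step_sum s))//.
apply: eq_integral => x _; congr (_%:E); rewrite /= /step_sum big_map /= -sqrrN.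
congr (_ ^+ 2); rewrite opprD !opprK -sumrN; congr (_ + _).
by apply: eq_bigr => p _; rewrite rmorphN/= mulNr.
Qed.

(** Splits [h] into positive and negative parts, each dominated by |h|. *)
Lemma step_approximableT h : measurable_fun setT h ->
  (sqintegral mu h < +oo)%E -> step_approximable h.
Proof.
move=> mh hoo.
have le (g : T -> R) : measurable_fun setT g -> (forall x, `|g x| <= `|h x|) ->
    (sqintegral mu g < +oo)%E.
  move=> mg gh; apply: le_lt_trans hoo; apply: ge0_le_integral => //.
  - by move=> x _; rewrite lee_fin sqr_ge0.
  - by apply/measurable_EFinP/measurable_funX.
  - by apply/measurable_EFinP/measurable_funX.
  - move=> x _; rewrite lee_fin -[g x ^+ 2]real_normK ?num_real//.
    by rewrite -[h x ^+ 2]real_normK ?num_real// ler_pXn2r ?nnegrE.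
pose p x := Num.max (h x) 0; pose q x := Num.max (- h x) 0.
have mp : measurable_fun setT p by exact: measurable_maxr.
have mq : measurable_fun setT q.
  by apply: measurable_maxr => //; exact: measurableT_comp.
have pa : step_approximable p.
  apply: step_approximable_ge0 => //.
    by move=> x; rewrite /p le_max lexx orbT.
  by apply: le => // x; rewrite /p; case: (ltP (h x) 0) => _; rewrite ?normr0.
have qa : step_approximable q.
  apply: step_approximable_ge0 => //.
    by move=> x; rewrite /q le_max lexx orbT.
  by apply: le => // x; rewrite /q; case: (ltP (- h x) 0) => _; rewrite ?normr0 ?normrN.
rewrite (_ : h = p \+ \- q).
  by apply: step_approximableD => //; exact: step_approximableN.
apply/funext => x /=; rewrite /p /q.
by case: (leP (h x) 0); case: (leP (- h x) 0); lra.
Qed.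

End step_sum.

(** * A countable generator of the Borel sets of R^d *)

Lemma tuple_generator (R : realType) n :
  @measurable _ (euclid R n) `<=` <<s range (fun p : 'I_n * rat =>
    [set t : euclid R n | ratr p.2 < tnth t p.1]) >>.
Proof.
set G := range _.
(* Tuples are given the sigma-algebra generated by the rational half-spaces. Once the coordinates
   are measurable for it, so is the identity into the Borel structure, which is the claim. *)
have mtnth (i : 'I_n) :
    measurable_fun setT (fun t : g_sigma_algebraType G => tnth t i : measurableTypeR R).
  move=> mT; apply: (measurability _ (RGenOInfty.measurableE R)) => //.
  move=> _ [_ [x ->] <-]; rewrite setTI.
  (* An open ray from x is the union of the open rays from rationals q > x. *)
  rewrite (_ : _ @^-1` _ = \bigcup_(q : rat)
      (if x < ratr q then [set t | ratr q < tnth t i] else set0)).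
    apply: bigcupT_measurable_rat => q; case: ifP => _; last exact: measurable0.
    by apply: sub_sigma_algebra; exists (i, q).
  apply/seteqP; split => [t|t [q _]] /=; rewrite in_itv/= andbT.
    move=> /rat_in_itvoo[q]; rewrite in_itv/= => /andP[xq qt].
    by exists q => //; rewrite xq.
  by case: ifP => // xq; exact: lt_trans xq.
have mid : measurable_fun setT (fun t : g_sigma_algebraType G => t : euclid R n).
  by apply/measurable_fun_tnthP => i; exact: mtnth.
by move=> B mB; have := mid measurableT B mB; rewrite setTI.
Qed.

(** * Hilbert space geometry of L^2 *)

Section complex_parts.
Variable R : realType.
Implicit Types z w : R[i].

Lemma complexReD z w : complex.Re (z + w) = complex.Re z + complex.Re w.
Proof. by case: z w => ? ? []. Qed.

Lemma complexImD z w : complex.Im (z + w) = complex.Im z + complex.Im w.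
Proof. by case: z w => ? ? []. Qed.

Lemma complexReN z : complex.Re (- z) = - complex.Re z.
Proof. by case: z. Qed.

Lemma complexImN z : complex.Im (- z) = - complex.Im z.
Proof. by case: z. Qed.

Lemma normc_ge0 z : 0 <= normc z.
Proof. by case: z => ? ?; exact: sqrtr_ge0. Qed.

End complex_parts.

Section complex_integral.
Context d (T : measurableType d) (R : realType).
Variable mu : {measure set T -> \bar R}.
Implicit Types (F G : T -> R[i]) (f g : sqfun mu) (u v w : L2 mu).
Local Open Scope quotient_scope.

Definition cintegrable F :=
  mu.-integrable setT (EFin \o (@complex.Re R \o F)) /\
  mu.-integrable setT (EFin \o (@complex.Im R \o F)).

Lemma cintegralD F G : cintegrable F -> cintegrable G ->
  cintegral mu (fun x => F x + G x) = cintegral mu F + cintegral mu G.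
Proof.
move=> [rF iF] [rG iG]; rewrite /cintegral.
apply/eqP; rewrite eq_complex /= -!RintegralD//.
by apply/andP; split; apply/eqP; apply: eq_Rintegral => x _;
  rewrite ?complexReD ?complexImD.
Qed.

Lemma cintegralZ (a : R[i]) F : cintegrable F ->
  cintegral mu (fun x => a * F x) = a * cintegral mu F.
Proof.
move=> [rF iF]; case: a => a b; rewrite /cintegral.
have Zr (c : R) (h : T -> R) : mu.-integrable setT (EFin \o h) ->
    mu.-integrable setT (EFin \o (fun x => c * h x)).
  by move=> /(integrableZl measurableT c); apply: eq_integrable.
rewrite (_ : (fun x => complex.Re _) = (fun x =>
    a * complex.Re (F x) - b * complex.Im (F x))); last first.
  by apply/funext => x; case: (F x).
rewrite (_ : (fun x => complex.Im _) = (fun x =>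
    a * complex.Im (F x) + b * complex.Re (F x))); last first.
  by apply/funext => x; case: (F x).
by rewrite RintegralB ?RintegralD ?RintegralZl//; exact: Zr.
Qed.

(** Both parts of the product are at most |f|^2 + |g|^2 in absolute value, by expanding squares of
    sums and differences of coordinates. *)
Lemma cintegrableM f g : cintegrable (fun x => f x * (g x)^*).
Proof.
have [mr mi] := cmeasurableM (sqfun_measurable f) (sqfun_measurable g).
have bound (h : T -> R) : measurable_fun setT h ->
    (forall x, `|h x| <= normc (f x) ^+ 2 + normc (g x) ^+ 2) ->
    mu.-integrable setT (EFin \o h).
  move=> mh hfg; apply: (@le_integrable _ _ _ mu _ measurableT _
    (fun x => (normc (f x) ^+ 2)%:E + (normc (g x) ^+ 2)%:E)%E).
  - exact/measurable_EFinP.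
  - move=> x _ /=; rewrite lee_fin; apply: le_trans (hfg x) _.
    exact: ler_norm.
  - have sq (k : sqfun mu) : mu.-integrable setT (fun x => (normc (k x) ^+ 2)%:E).
      have /asboolP[mk Ik] := sqfunP k; apply/integrableP; split.
        exact: measurable_sqr_normc.
      by under eq_integral do rewrite gee0_abs ?lee_fin ?sqr_ge0//.
    exact: integrableD.
split; apply: bound => // x; rewrite /= !sqr_normcE ler_norml;
  case: (f x) (g x) => a b [a' b'] /=.
- by have := sqr_ge0 (a + a'); have := sqr_ge0 (a - a');
    have := sqr_ge0 (b + b'); have := sqr_ge0 (b - b');
    rewrite !sqrrB !sqrrD; move=> *; apply/andP; split; nra.
- by have := sqr_ge0 (a + b'); have := sqr_ge0 (a - b');
    have := sqr_ge0 (b + a'); have := sqr_ge0 (b - a');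
    rewrite !sqrrB !sqrrD; move=> *; apply/andP; split; nra.
Qed.

Lemma innerDl u v w : inner (u + v) w = inner u w + inner v w.
Proof.
elim/quotW: u => f; elim/quotW: v => g; elim/quotW: w => h.
rewrite -pi_L2D !inner_pi -cintegralD; do ?exact: cintegrableM.
by congr cintegral; apply/funext => x; rewrite -mulrDl.
Qed.

Lemma innerZl a u w : inner (a *: u) w = a * inner u w.
Proof.
elim/quotW: u => f; elim/quotW: w => h.
rewrite pi_L2Z !inner_pi -cintegralZ; last exact: cintegrableM.
by congr cintegral; apply/funext => x; rewrite mulrA.
Qed.

Lemma inner_conj u v : inner v u = (inner u v)^*.
Proof.
elim/quotW: u => f; elim/quotW: v => g; rewrite !inner_pi.
have [_ ri] := cintegrableM f g.
rewrite /cintegral /=; congr (_ +i* _)%C.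
  by apply: eq_Rintegral => x _; case: (f x) (g x) => ? ? [? ?] /=; ring.
rewrite -[RHS]mulN1r -RintegralZl//.
by apply: eq_Rintegral => x _; case: (f x) (g x) => ? ? [? ?] /=; ring.
Qed.

Lemma innerNl u w : inner (- u) w = - inner u w.
Proof. by rewrite -scaleN1r innerZl mulN1r. Qed.

Lemma innerDr u v w : inner u (v + w) = inner u v + inner u w.
Proof. by rewrite inner_conj innerDl rmorphD/= -!inner_conj. Qed.

Lemma innerZr a u w : inner u (a *: w) = a^* * inner u w.
Proof. by rewrite inner_conj innerZl rmorphM/= -inner_conj. Qed.

Lemma innerNr u w : inner u (- w) = - inner u w.
Proof. by rewrite inner_conj innerNl rmorphN/= -inner_conj. Qed.

Lemma Re_cintegral_norm (F : T -> R[i]) :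
  complex.Re (cintegral mu (fun x => F x * (F x)^*)) =
  fine (\int[mu]_x (normc (F x) ^+ 2)%:E)%E.
Proof.
rewrite /= /Rintegral; congr fine; apply: eq_integral => x _.
by rewrite sqr_normcE; case: (F x) => ? ? /=; congr (_%:E); ring.
Qed.

Lemma Re_inner_ge0 u : 0 <= complex.Re (inner u u).
Proof.
elim/quotW: u => f; rewrite inner_pi Re_cintegral_norm fine_ge0// integral_ge0// => x _.
by rewrite lee_fin sqr_ge0.
Qed.

Lemma Im_inner u : complex.Im (inner u u) = 0.
Proof.
have := inner_conj u u; case: (inner u u) => a b [] /eqP.
by rewrite -addr_eq0 -mulr2n mulrn_eq0 => /eqP.
Qed.

Lemma L2normE u : L2norm u ^+ 2 = complex.Re (inner u u).
Proof. by rewrite sqr_sqrtr// Re_inner_ge0. Qed.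

Lemma innerE u : inner u u = (L2norm u ^+ 2)%:C%C.
Proof. by rewrite L2normE; have := Im_inner u; case: inner => a b /= ->. Qed.

Lemma L2norm_ge0 u : 0 <= L2norm u.
Proof. exact: sqrtr_ge0. Qed.

Lemma L2norm_eq0 u : L2norm u = 0 -> u = 0.
Proof.
move=> u0; have : complex.Re (inner u u) = 0 by rewrite -L2normE u0 expr0n.
clear u0.
elim/quotW: u => f; rewrite inner_pi Re_cintegral_norm => /eqP.
have /asboolP[mf If] := sqfunP f.
rewrite fine_eq0 ?ge0_fin_numE ?integral_ge0//; last first.
  by move=> x _; rewrite lee_fin sqr_ge0.
move=> /eqP f0; rewrite -(_ : \pi 0 = 0); last by rewrite !piE.
apply/L2_eqP.
have := ae_eq_integral_abs mu measurableT (measurable_sqr_normc mf).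
under eq_integral do rewrite gee0_abs ?lee_fin ?sqr_ge0//.
move=> [/(_ f0) + _]; apply: filterS => x /= /(_ Logic.I)[/eqP].
by rewrite sqrf_eq0 => /eqP/eq0_normc.
Qed.

Lemma L2norm_gt0 u : u != 0 -> 0 < L2norm u.
Proof.
by move=> u0; rewrite lt0r L2norm_ge0 andbT; apply: contra_neq u0; exact: L2norm_eq0.
Qed.

(** Testing against [u - v] makes its norm vanish. This is how identities for adjoints, known only
    through inner products, are proved. *)
Lemma inner_inj u v : (forall w, inner w u = inner w v) -> u = v.
Proof.
move=> uv; apply/eqP; rewrite -subr_eq0; apply/eqP/L2norm_eq0.
apply/eqP; rewrite -sqrf_eq0 L2normE.
by rewrite innerDr innerNr uv subrr.
Qed.

Lemma L2normZ a u : L2norm (a *: u) = normc a * L2norm u.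
Proof.
apply/eqP; rewrite -(@eqrXn2 _ 2) ?mulr_ge0 ?L2norm_ge0 ?normc_ge0//.
rewrite L2normE innerZl innerZr mulrA innerE exprMn sqr_normcE.
by case: a => a b /=; apply/eqP; ring.
Qed.

Lemma Cauchy_Schwarz u v : normc (inner u v) <= L2norm u * L2norm v.
Proof.
have [->|v0] := eqVneq v 0.
  by rewrite -(scale0r (0 : L2 mu)) innerZr L2normZ rmorph0 mul0r normc0 mul0r mulr0.
have n0 : 0 < L2norm v := L2norm_gt0 v0.
rewrite -(@ler_pXn2r _ 2) ?nnegrE ?mulr_ge0 ?L2norm_ge0 ?normc_ge0//.
rewrite exprMn sqr_normcE.
have q0 : 0 < L2norm v ^+ 2 by rewrite exprn_gt0.
(* The residual of the orthogonal projection of [u] onto [v]; multiplying its squared norm by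
   ||v||^2 gives the inequality. *)
have := Re_inner_ge0 (u - ((L2norm v ^- 2)%:C%C * inner u v) *: v).
rewrite !innerDl !innerDr !innerNl !innerNr !innerZl !innerZr !innerE (inner_conj u v).
move: q0; set q := L2norm v ^+ 2; set p := L2norm u ^+ 2 => q0.
case: (inner u v) => x y /= H.
have := mulr_ge0 (ltW q0) H; rewrite -[in X in _ -> X]subr_ge0.
by congr (is_true (0 <= _)); field; exact: lt0r_neq0.
Qed.

End complex_integral.

(** * Separability of L^2 *)

Section separability.
Context d (T : measurableType d) (R : realType) (I : countType).
Variables (mu : {sigma_finite_measure set T -> \bar R}) (G : I -> set T).
Hypotheses (mG : forall i, measurable (G i))
  (GT : @measurable d T `<=` <<s range G >>).
Local Open Scope quotient_scope.

(** Reduces distances in L^2 to real square integrals, where density is available. *)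
Lemma le_L2norm_piB (f g : sqfun mu) : ((L2norm (\pi_(L2 mu) f - \pi_(L2 mu) g) ^+ 2)%:E <=
  sqintegral mu (fun x => complex.Re (f x) - complex.Re (g x))%R +
  sqintegral mu (fun x => complex.Im (f x) - complex.Im (g x))%R)%E.
Proof.
have [mrf mif] := sqfun_measurable f; have [mrg mig] := sqfun_measurable g.
rewrite L2normE (_ : _ - _ = \pi_(L2 mu) (f - g)); last by rewrite !piE.
rewrite inner_pi Re_cintegral_norm fineK; last first.
  have /asboolP[_ fgoo] := sqfunP (f - g).
  by rewrite ge0_fin_numE// integral_ge0// => x _; rewrite lee_fin sqr_ge0.
rewrite /sqintegral -ge0_integralD//.
- by under eq_integral do rewrite sqr_normcE complexReD complexImD complexReN complexImN EFinD.
- by move=> x _; rewrite lee_fin sqr_ge0.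
- by apply/measurable_EFinP/measurable_funX; exact: measurable_funB.
- by move=> x _; rewrite lee_fin sqr_ge0.
- by apply/measurable_EFinP/measurable_funX; exact: measurable_funB.
Qed.

(* Separability stated through sets of small diameter, so that the approximating
   step functions need not be made elements of L2. *)
Lemma L2_countable_small_cover : exists (J : countType) (E : nat -> J -> set (L2 mu)),
  (forall k u, exists j, E k j u) /\
  (forall k j u v, E k j u -> E k j v -> L2norm (u - v) <= k.+1%:R^-1).
Proof.
have /sigma_finiteP[F [FT ndF mF]] := sigma_finiteT mu.
have mFn n : measurable (F n) by have [] := mF n.
have Foo n : (mu (F n) < +oo)%E by have [] := mF n.
pose J : countType := seq (rat * nat * GenTree.tree I).
(* Two functions with squared distance below [dl] to the same step function have squared distance
   below 4 [dl]; real and imaginary parts together give 8 [dl], the square of 1/(k+1). *)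
pose dl k : R := k.+1%:R^-1 ^+ 2 / 8.
have dl0 k : 0 < dl k by rewrite divr_gt0// exprn_gt0// invr_gt0.
pose D : J -> T -> R := step_sum R G F.
have mD s : measurable_fun setT (D s) by exact: measurable_step_sum.
exists ((J * J)%type : countType), (fun k j => [set u : L2 mu |
  (sqintegral mu (fun x => complex.Re (repr u x) - D j.1 x)%R < (dl k)%:E)%E /\
  (sqintegral mu (fun x => complex.Im (repr u x) - D j.2 x)%R < (dl k)%:E)%E]).
split=> [k u|k [s t] u v /= [us ut] [vs vt]].
  have [mr mi] := sqfun_measurable (repr u).
  have /asboolP[_ uoo] := sqfunP (repr u).
  have dense (h : T -> R) : measurable_fun setT h ->
      (forall x, h x ^+ 2 <= normc (repr u x) ^+ 2) ->
      exists s, (sqintegral mu (h \- D s)%R < (dl k)%:E)%E.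
    move=> mh hu; have [] : step_approximable mu G F h => // [|_]; last exact.
    apply: step_approximableT => //.
    apply: le_lt_trans uoo; apply: ge0_le_integral => //.
    - by move=> x _; rewrite lee_fin sqr_ge0.
    - by apply/measurable_EFinP/measurable_funX.
    - exact: measurable_sqr_normc (sqfun_measurable _).
    - by move=> x _; rewrite lee_fin.
  have [|s us] := dense _ mr.
    by move=> x; rewrite sqr_normcE lerDl sqr_ge0.
  have [|t ut] := dense _ mi.
    by move=> x; rewrite sqr_normcE lerDr sqr_ge0.
  by exists (s, t).
have [mru miu] := sqfun_measurable (repr u).
have [mrv miv] := sqfun_measurable (repr v).
have close (f g h : T -> R) : measurable_fun setT f -> measurable_fun setT g ->
    measurable_fun setT h ->
    (sqintegral mu (f \- h)%R < (dl k)%:E)%E ->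
    (sqintegral mu (g \- h)%R < (dl k)%:E)%E ->
    (sqintegral mu (f \- g)%R < (4 * dl k)%:E)%E.
  move=> mf mg mh fh gh.
  rewrite (_ : (f \- g)%R = (f \- h) \+ (h \- g)); last first.
    by apply/funext => x /=; rewrite addrA subrK.
  have e4 : 4 * dl k / 4 = dl k by field.
  apply: sqintegralD_lt; rewrite ?e4//; try exact: measurable_funB.
  rewrite (_ : sqintegral _ _ = sqintegral mu (g \- h)%R)//.
  by apply: eq_integral => x _; congr (_%:E); rewrite /= -sqrrN opprB.
rewrite -(@ler_pXn2r _ 2) ?nnegrE ?L2norm_ge0 ?invr_ge0//.
rewrite -lee_fin -(reprK u) -(reprK v); apply: le_trans (le_L2norm_piB _ _) _.
rewrite (_ : k.+1%:R^-1 ^+ 2 = 4 * dl k + 4 * dl k); last by rewrite /dl; field.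
rewrite EFinD; apply: leeD; apply: ltW; first exact: (close _ _ (D s)).
exact: (close _ _ (D t)).
Qed.

End separability.

(** * Essential points of a countable family of sets *)

Lemma exists_essential_point d (T : measurableType d) (R : realType)
    (mu : {measure set T -> \bar R}) (J : countType) (E : J -> set T) :
  (0 < mu setT)%E -> exists z, forall j, E j z -> ~ mu.-negligible (E j).
Proof.
move=> mu0; apply: contrapT => noz.
(* The negligible members, enumerated by [nat]; every other index gets the empty set, so the union
   remains negligible. *)
pose N n : set T := if unpickle n is Some j then
  (if `[< mu.-negligible (E j) >] then E j else set0) else set0.
have nN n : mu.-negligible (N n).
  rewrite /N; case: (unpickle n) => [j|]; last exact: negligible_set0.
  by case: ifPn => [/asboolP//|_]; exact: negligible_set0.
have : mu.-negligible (setT : set T).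
  apply: negligibleS (negligible_bigcup nN) => z _.
  apply: contrapT => Nz; apply: noz; exists z => j Ejz nE; apply: Nz.
  by exists (pickle j) => //; rewrite /N pickleK; case: asboolP.
by move/negligibleP => /(_ measurableT) mu00; rewrite mu00 ltxx in mu0.
Qed.

(** * Quadratic form of a bounded operator *)

Section quadratic_form.
Context d (T : measurableType d) (R : realType).
Variable mu : {measure set T -> \bar R}.
Variables (S : {linear L2 mu -> L2 mu}) (M : R).
Hypothesis SM : forall u, L2norm (S u) <= M * L2norm u.
Implicit Types u v : L2 mu.

(** One entry changes at a time: <Sv,v> - <Su,u> = - <Su,u-v> - <S(u-v),v>, and Cauchy-Schwarz
    bounds each term by M ||u - v||. *)
Lemma quadratic_form_lipschitz u v : L2norm u = 1 -> L2norm v = 1 ->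
  normc (inner (S v) v) <= normc (inner (S u) u) + 2 * M * L2norm (u - v).
Proof.
move=> u1 v1.
have -> : inner (S v) v = inner (S u) u +
    (- inner (S u) (u - v) + - inner (S (u - v)) v).
  by rewrite linearB/= innerDr innerDl !innerNr innerNl; ring.
apply: le_trans (le_normcD _ _) _; rewrite lerD2l.
apply: le_trans (le_normcD _ _) _; rewrite !normcN.
have := Cauchy_Schwarz (S u) (u - v); have := Cauchy_Schwarz (S (u - v)) v.
have := ler_wpM2r (L2norm_ge0 (u - v)) (SM u); have := SM (u - v).
by rewrite u1 v1; lra.
Qed.

Lemma quadratic_formZ (a : R) u :
  normc (inner (S (a%:C%C *: u)) (a%:C%C *: u)) = a ^+ 2 * normc (inner (S u) u).
Proof.
rewrite linearZZ innerZl innerZr mulrA normcM; congr (_ * _).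
have -> : a%:C%C * (a%:C%C)^* = ((a ^+ 2)%:C)%C :> R[i].
  by apply/eqP; rewrite eq_complex /=; apply/andP; split; apply/eqP; ring.
by rewrite /= expr0n/= addr0 sqrtr_sqr ger0_norm ?sqr_ge0.
Qed.

End quadratic_form.

(** * Unitarity of the time-frequency shifts *)

Section time_frequency_shifts.
Variables (R : realType) (d : nat).
Local Notation leb := (lebesgue_euclid R d).
Local Notation H := (L2euclid R d).
Implicit Types (z : euclid R d * euclid R d) (u v : H) (S : {linear H -> H}).
Local Open Scope quotient_scope.

(** The phases cancel against their conjugates, and Lebesgue measure is translation invariant. *)
Lemma inner_tfshift z u v : inner (tfshift z u) (tfshift z v) = inner u v.
Proof.
elim/quotW: u => f; elim/quotW: v => g; rewrite !tfshift_pi !inner_pi.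
rewrite -[RHS](@cintegral_vsub _ _ z.1); last first.
  by apply: cmeasurableM; exact: sqfun_measurable.
congr cintegral; apply/funext => y.
rewrite /= /tfshift_fun rmorphM/= conj_cis mulrACA -cisD subrr.
by rewrite /cis cos0 sin0 mul1r.
Qed.

(** Gives surjectivity, which together with the isometry property makes the shift unitary. *)
Lemma tfshift_tfshift_inv z u : tfshift z (tfshift_inv z u) = u.
Proof.
elim/quotW: u => f; rewrite /tfshift_inv (tfshift_pi (_, _)) pi_L2Z tfshift_pi.
apply/L2_eqP; apply: aeW => y.
change (cis (2 * trigo.pi * vdot z.2 y) * (cis (- (2 * trigo.pi * vdot z.1 z.2)) *
    (cis (2 * trigo.pi * vdot (vopp z.2) (vsub y z.1)) *
     f (vsub (vsub y z.1) (vopp z.1)))) = f y).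
rewrite vsubNK !mulrA -!cisD vdotNl vdotB (vdotC z.1).
rewrite (_ : _ + _ = 0); last by ring.
by rewrite /cis cos0 sin0 mul1r.
Qed.

Lemma adjoint_tfshiftK z u : adjoint (tfshift z) (tfshift z u) = u.
Proof. by apply: inner_inj => w; rewrite -adjoint_tfshiftP inner_tfshift. Qed.

Lemma tfshift_adjointK z u : tfshift z (adjoint (tfshift z) u) = u.
Proof. by rewrite -[u in LHS](tfshift_tfshift_inv z) adjoint_tfshiftK tfshift_tfshift_inv. Qed.

Lemma adjoint_tfshiftB z u v : adjoint (tfshift z) (u - v) =
  adjoint (tfshift z) u - adjoint (tfshift z) v.
Proof.
by apply: inner_inj => w; rewrite innerDr innerNr -!adjoint_tfshiftP innerDr innerNr.
Qed.

Lemma L2norm_tfshift z u : L2norm (tfshift z u) = L2norm u.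
Proof. by rewrite /L2norm inner_tfshift. Qed.

Lemma L2norm_adjoint_tfshift z u : L2norm (adjoint (tfshift z) u) = L2norm u.
Proof. by rewrite -(L2norm_tfshift z) tfshift_adjointK. Qed.

Lemma QsymE S u z : Qsym S u z =
  inner (S (adjoint (tfshift z) u)) (adjoint (tfshift z) u).
Proof. by rewrite /Qsym /alpha /= adjoint_tfshiftP. Qed.

(** * Upper and lower bounds for the essential supremum over Omega *)

Section restriction.
Variables (Omega : set (phase R d)) (mOmega : measurable Omega).
Hypothesis Omega_gt0 : (0 < lebesgue_phase Omega)%E.

Local Notation nu := (mrestr (@lebesgue_phase R d) mOmega).

Lemma mrestr_phase_gt0 : (0 < nu setT)%E.
Proof. by rewrite /mrestr setTI. Qed.

(** [Lnorm] at infinite exponent is defined by cases on the total measure; |Omega| > 0 selects the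
    essential supremum. *)
Lemma Linfty_normE (F : phase R d -> R[i]) :
  Linfty_norm mOmega F = ess_sup nu (fun z => (normc (F z))%:E).
Proof.
rewrite /Linfty_norm unlock mrestr_phase_gt0; congr ess_sup.
by apply/funext => z /=; rewrite ger0_norm ?normc_ge0.
Qed.

(** The bound holds at every z: pi(z)^* u has the norm of [u], and rescaled to norm 1 it competes in
    the numerical radius. *)
Lemma Linfty_norm_Qsym_le S u : u != 0 ->
  (Linfty_norm mOmega (Qsym S u) / (L2norm u ^+ 2)%:E <= numerical_radius S)%E.
Proof.
move=> u0; have n0 : 0 < L2norm u := L2norm_gt0 u0.
rewrite inver gt_eqF ?exprn_gt0// lee_pdivrMr ?exprn_gt0// Linfty_normE; apply/ess_supP.
apply: aeW => z; rewrite QsymE; set v := adjoint _ _.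
have v1 : L2norm ((L2norm u)^-1%:C%C *: v) = 1.
  rewrite L2normZ L2norm_adjoint_tfshift /= expr0n/= addr0 sqrtr_sqr.
  by rewrite ger0_norm ?invr_ge0 ?L2norm_ge0// mulVf ?gt_eqF.
rewrite -lee_pdivrMr ?exprn_gt0//; apply: ereal_sup_ubound.
exists ((L2norm u)^-1%:C%C *: v) => //.
by rewrite quadratic_formZ exprVn -EFinM mulrC.
Qed.

Lemma Linfty_norm_Qsym_ge S (M : R) g :
  (forall u, L2norm (S u) <= M * L2norm u) -> L2norm g = 1 ->
  exists z, ((normc (inner (S g) g))%:E <=
    Linfty_norm mOmega (Qsym S (tfshift z g)))%E.
Proof.
move=> SM g1.
have M0 : 0 <= M by have := SM g; rewrite g1 mulr1; apply: le_trans; exact: L2norm_ge0.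
have mG (p : 'I_d * rat) :
    measurable [set t : euclid R d | ratr p.2 < tnth t p.1].
  have := @measurable_tnth _ (measurableTypeR R) d p.1 measurableT
    `]ratr p.2, +oo[%classic (measurable_itv _).
  by rewrite setTI (_ : _ @^-1` _ = [set t | ratr p.2 < tnth t p.1])//;
    apply/seteqP; split=> t /=; rewrite in_itv/= andbT.
have [J [E [Ecover Esmall]]] := L2_countable_small_cover
  (lebesgue_euclid R d) mG (@tuple_generator R d).
(* Indexing by pairs (k, j) lets one [z0] serve all diameters 1/(k+1) at once. *)
have [z0 Hz0] := @exists_essential_point _ (phase R d) R nu (nat * J)%type
  (fun kj => [set z | E kj.1 kj.2 (tfshift z g)]) mrestr_phase_gt0.
exists z0; rewrite Linfty_normE; set Q := fun z => _.
(* [z0] was fixed before [e], so a single vector reaches the bound without loss; attainment rests on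
   this. *)
apply/lee_addgt0Pr => e e0.
rewrite leNgt; apply/negP => lt_e.
(* Makes the Lipschitz error on a cell of diameter 1/(k+1) smaller than [e]. *)
have [k ke] : exists k : nat, 2 * M * k.+1%:R^-1 < e.
  have Me : 0 <= 2 * M / e by rewrite divr_ge0 ?mulr_ge0// ltW.
  exists (Num.bound (2 * M / e)); rewrite ltr_pdivrMr// [ltRHS]mulrC -ltr_pdivrMr//.
  by apply: lt_trans (archi_boundP Me) _; rewrite ltr_nat.
have [j Ej] := Ecover k (tfshift z0 g).
apply: (Hz0 (k, j)) => //.
(* On the whole cell of [z0], [Q] would exceed its essential supremum; the cell would then be
   negligible, against the choice of [z0]. *)
apply: negligibleS (ess_sup_ge nu Q) => z Ez.
apply/negP; rewrite -ltNge -(lteD2rE _ _ (_ : e%:E \is a fin_num))//.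
apply: lt_le_trans lt_e _; rewrite /Q -EFinD lee_fin QsymE.
set v := adjoint _ _.
have v1 : L2norm v = 1 by rewrite L2norm_adjoint_tfshift L2norm_tfshift.
apply: le_trans (quadratic_form_lipschitz SM v1 g1) _; rewrite lerD2l.
apply: le_trans (ltW ke); rewrite ler_wpM2l ?mulr_ge0//.
(* As pi(z)^* is isometric, ||g - v|| is the distance between pi(z) g and pi(z0) g, which share a
   cell. *)
rewrite -[g](adjoint_tfshiftK z) -adjoint_tfshiftB L2norm_adjoint_tfshift.
exact: Esmall Ej Ez.
Qed.

End restriction.
End time_frequency_shifts.

(** * Equality of the two suprema, and attainment *)

Theorem proposition3p10 (R : realType) (d : nat)
    (Omega : set (phase R d)) (mOmega : measurable Omega)
    (Omega_gt0 : (0 < lebesgue_phase Omega)%E)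
    (S : {linear L2euclid R d -> L2euclid R d}) (bS : bounded_op S) :
  Lambda_infty mOmega S = numerical_radius S /\
  ((exists g : L2euclid R d,
      L2norm g = 1 /\ (normc (inner (S g) g))%:E = numerical_radius S) ->
   exists f : L2euclid R d,
      f != 0 /\
      (Linfty_norm mOmega (Qsym S f) / (L2norm f ^+ 2)%:E)%E =
      Lambda_infty mOmega S).
Proof.
have [M SM] := bS.
(* One [f] reaches |<Sg,g>| exactly; this yields both the lower bound and attainment. *)
have lower g : L2norm g = 1 -> exists f : L2euclid R d, f != 0 /\
    ((normc (inner (S g) g))%:E <=
     Linfty_norm mOmega (Qsym S f) / (L2norm f ^+ 2)%:E)%E.
  move=> g1; have [z gz] := Linfty_norm_Qsym_ge mOmega Omega_gt0 SM g1.
  exists (tfshift z g); rewrite L2norm_tfshift g1 expr1n inve1 mule1; split=> //.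
  apply/eqP => f0; have := L2norm_tfshift z g; rewrite f0 g1.
  by rewrite -(scale0r (0 : L2euclid R d)) L2normZ normc0 mul0r => /esym/eqP; rewrite oner_eq0.
have eqL : Lambda_infty mOmega S = numerical_radius S.
  apply/eqP; rewrite eq_le; apply/andP; split.
    by apply: ge_ereal_sup => _ [f f0 <-]; exact: Linfty_norm_Qsym_le.
  apply: ge_ereal_sup => _ [g g1 <-]; have [f [f0 gf]] := lower g g1.
  by apply: le_trans gf _; apply: ereal_sup_ubound; exists f.
(* For an extremal [g], the quotient at [f] is at least w(S), and the upper bound forces
   equality. *)
split=> // -[g [g1 gw]]; have [f [f0 gf]] := lower g g1; exists f; split=> //.
apply/eqP; rewrite eq_le; apply/andP; split.
  by rewrite eqL; exact: Linfty_norm_Qsym_le.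
by rewrite eqL -gw.
Qed.
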